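(* Let $(A,+,\cdot,\leq_A)$ be an additively cancellative positive information algebra and let $(L,\leq_L)$ be a chain (totally ordered set) disjoint from $A$. Let $S=A\uplus_{\mathrm{ord}}L$ be the overflow semiring. Let $f=\sum_{n=0}^\infty a_nX^n\in S[[X]]$ be a formal power series with $a_0=1$. If $f\neq 1$, then $f^2=f$ if and only if all of the following hold: (1) every nonzero coefficient $a_n$ with $n\geq 1$ lies in $L$; (2) the set $\{n\geq 1: a_n\neq 0\}$ is infinite; (3) for every $n\geq 1$, $a_n\geq\sup_{1\leq i\leq n-1}a_ia_{n-i}$.
   Context: All semirings are commutative: $(S,+,0)$ and $(S,\cdot,1)$ are commutative monoids, $1\neq 0$, multiplication distributes over addition, and $0$ is absorbing. A semiring is zerosumfree if $a+b=0$ implies $a=b=0$, and entire if $ab=0$ implies $a=0$ or $b=0$; an information algebra is a zerosumfree entire semiring. A positive information algebra is an information algebra with a partial order $\leq$ compatible with $+$ and $\cdot$ (i.e. $x\leq y$ implies $x+z\leq y+z$ and $xz\leq yz$) and having $0$ as least element. Additively cancellative means $a+c=b+c$ implies $a=b$. Overflow semiring $S=A\uplus_{\mathrm{ord}}L$: for a positive information algebra $A$ and a join-semilattice $L$ disjoint from $A$, $S=A\cup L$ with the order extending those of $A$ and $L$ by $a\leq\ell$ for all $a\in A,\ell\in L$ (and never $\ell\leq a$), and operations: $x+y=x+_Ay$ if $x,y\in A$, $x+y=\sup\{x,y\}$ otherwise; $xy=x\cdot_Ay$ if $x,y\in A\setminus\{0\}$, $xy=0$ if $x=0$ or $y=0$,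 and $xy=\sup\{x,y\}$ otherwise. With these, $S$ is a positive information algebra. $S[[X]]$ carries the usual coefficientwise addition and convolution product. Suprema are taken in $(S,\leq)$, and the empty supremum (case $n=1$) is the least element $0$. *)

(* Defs.v *)
From HB Require Import structures.
From mathcomp Require Import all_boot all_order all_algebra.
From mathcomp Require Import boolp classical_sets cardinality.

Set Implicit Arguments.
Unset Strict Implicit.
Unset Printing Implicit Defensive.

Import Order.TTheory GRing.Theory.
Local Open Scope ring_scope.

HB.mixin Record ComNzSemiRing_isInformationAlgebra A
    of GRing.ComNzSemiRing A := {
  zerosumfree : forall a b : A, a + b = 0 -> a = 0 /\ b = 0;
  entire : forall a b : A, a * b = 0 -> a = 0 \/ b = 0;
}.

#[short(type="infoAlgType")]
HB.structure Definition InformationAlgebra :=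
  {A of GRing.ComNzSemiRing A & ComNzSemiRing_isInformationAlgebra A}.

(* The order is a field of the mixin rather than an Order.POrder instance:
   Num.POrderedZmodule already is the join of the additive and the order
   hierarchies, and Hierarchy-Builder rejects a second one without opposites. *)
HB.mixin Record InformationAlgebra_isPositive A of InformationAlgebra A := {
  ple : rel A;
  ple_refl : reflexive ple;
  ple_anti : antisymmetric ple;
  ple_trans : transitive ple;
  pleD2r : forall z x y : A, ple x y -> ple (x + z) (y + z);
  pleM2r : forall z x y : A, ple x y -> ple (x * z) (y * z);
  ple0 : forall x : A, ple 0 x;
}.

#[short(type="posInfoAlgType")]
HB.structure Definition PositiveInformationAlgebra :=
  {A of InformationAlgebra A & InformationAlgebra_isPositive A}.

Definition additively_cancellative (A : nmodType) :=
  forall a b c : A, a + c = b + c -> a = b.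

(* The constructors make the union of A and L disjoint. *)
Inductive overflow (A L : Type) := Low of A | High of L.
Arguments Low {A L}.
Arguments High {A L}.

Definition overflow_to_sum A L (x : overflow A L) : A + L :=
  match x with Low a => inl a | High l => inr l end.
Definition overflow_of_sum A L (x : A + L) : overflow A L :=
  match x with inl a => Low a | inr l => High l end.

Lemma overflow_to_sumK A L :
  cancel (@overflow_to_sum A L) (@overflow_of_sum A L).
Proof. by case. Qed.

HB.instance Definition _ (A L : choiceType) :=
  Choice.copy (overflow A L) (can_type (@overflow_to_sumK A L)).

Fact overflow_display : Order.disp_t. Proof. exact: Order.Disp tt tt. Qed.

Section Overflow.
Variables (dL : Order.disp_t) (A : posInfoAlgType) (L : joinSemilatticeType dL).
Local Notation S := (overflow A L).
Implicit Types x y z : S.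

Definition overflow_le x y : bool :=
  match x, y with
  | Low a, Low b => ple a b
  | Low _, High _ => true
  | High _, Low _ => false
  | High l, High m => (l <= m)%O
  end.

Lemma overflow_le_refl : reflexive overflow_le.
Proof. by case=> x /=; rewrite ?ple_refl. Qed.

Lemma overflow_le_anti : antisymmetric overflow_le.
Proof. by case=> x [] y //= => [/ple_anti|/le_anti] ->. Qed.

Lemma overflow_le_trans : transitive overflow_le.
Proof. by case=> y [] x [] z //=; [apply: ple_trans|apply: le_trans]. Qed.

HB.instance Definition _ := Order.Le_isPOrder.Build overflow_display
  S overflow_le_refl overflow_le_anti overflow_le_trans.

(* For a in A and l in L one has a <= l, so sup {a, l} = l; see
   overflow_supremums below. *)
Definition overflow_add x y : S :=
  match x, y with
  | Low a, Low b => Low (a + b)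
  | Low _, High l | High l, Low _ => High l
  | High l, High m => High (Order.join l m)
  end.

Definition overflow_mul x y : S :=
  match x, y with
  | Low a, Low b => Low (a * b)
  | Low a, High l | High l, Low a => if a == 0 then Low 0 else High l
  | High l, High m => High (Order.join l m)
  end.

Lemma info_mul_eq0 (a b : A) : (a * b == 0) = (a == 0) || (b == 0).
Proof.
apply/eqP/orP => [/entire[]->|[]/eqP->]; rewrite ?mul0r ?mulr0 //.
- by left.
- by right.
Qed.

Lemma info_add_eq0 (a b : A) : (a + b == 0) = (a == 0) && (b == 0).
Proof.
by apply/eqP/andP => [/zerosumfree[-> ->]|[/eqP-> /eqP->]]; rewrite ?addr0.
Qed.

Lemma overflow_addA : associative overflow_add.
Proof. by case=> x [] y [] z //=; rewrite ?addrA ?joinA. Qed.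

Lemma overflow_addC : commutative overflow_add.
Proof. by case=> x [] y //=; rewrite 1?addrC 1?joinC. Qed.

Lemma overflow_add0 : left_id (Low 0) overflow_add.
Proof. by case=> x //=; rewrite add0r. Qed.

HB.instance Definition _ :=
  GRing.isNmodule.Build S overflow_addA overflow_addC overflow_add0.

Lemma overflow_mulC : commutative overflow_mul.
Proof. by case=> x [] y //=; rewrite 1?mulrC 1?joinC. Qed.

Lemma overflow_mul1 : left_id (Low 1) overflow_mul.
Proof. by case=> x /=; rewrite ?mul1r ?oner_eq0. Qed.

Lemma overflow_mul0 : left_zero (Low 0) overflow_mul.
Proof. by case=> x /=; rewrite ?mul0r ?eqxx. Qed.

Lemma overflow_mulA : associative overflow_mul.
Proof.
case=> x [] y [] z /=; rewrite ?mulrA ?joinA ?info_mul_eq0 //.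
- by case x0: (x == 0); case y0: (y == 0) => //=; rewrite ?x0 ?mulr0.
- by case x0: (x == 0); case z0: (z == 0);
    rewrite /= ?x0 ?z0 ?mulr0 ?mul0r.
- by case x0: (x == 0) => //=; rewrite eqxx.
- by case y0: (y == 0); case z0: (z == 0) => //=; rewrite ?z0 ?mul0r ?eqxx.
- by case y0: (y == 0) => //=; rewrite eqxx.
- by case z0: (z == 0) => //=; rewrite eqxx.
Qed.

Lemma overflow_mulDl : left_distributive overflow_mul overflow_add.
Proof.
case=> x [] y [] z /=; rewrite ?mulrDl ?info_add_eq0 //.
- by case: (x == 0); case: (y == 0) => //=; rewrite ?addr0 ?joinxx.
- by have [->|_] := eqVneq z 0; rewrite ?mulr0 ?add0r.
- by case: (x == 0) => //=; rewrite joinCA joinxx.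
- by have [->|_] := eqVneq z 0; rewrite /= ?mulr0 ?addr0.
- by case: (y == 0) => //=; rewrite -joinA joinxx.
- by case: (z == 0); rewrite /= ?addr0.
- by rewrite joinACA joinxx.
Qed.

Lemma overflow_one_neq0 : Low 1 != Low 0 :> S.
Proof. by apply/eqP => -[] /eqP; rewrite oner_eq0. Qed.

HB.instance Definition _ := GRing.Nmodule_isComNzSemiRing.Build S
  overflow_mulA overflow_mulC overflow_mul1 overflow_mulDl overflow_mul0
  overflow_one_neq0.

Lemma overflow_zerosumfree x y : x + y = 0 -> x = 0 /\ y = 0.
Proof. by case: x y => x [] y //= [] /zerosumfree[-> ->]. Qed.

Lemma overflow_entire x y : x * y = 0 -> x = 0 \/ y = 0.
Proof.
case: x y => x [] y //=.
- by case=> /entire[->|->]; [left|right].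
- by rewrite /GRing.mul /=; case: eqVneq => [->|] // _; left.
- by rewrite /GRing.mul /=; case: eqVneq => [->|] // _; right.
Qed.

HB.instance Definition _ := ComNzSemiRing_isInformationAlgebra.Build S
  overflow_zerosumfree overflow_entire.

Lemma overflow_leD2r z x y : (x <= y)%O -> (x + z <= y + z)%O.
Proof.
rewrite /Order.le /GRing.add /=.
case: x y z => x [] y [] z //=; rewrite ?leUr //.
- exact: pleD2r.
- by move=> xy; rewrite leU2.
Qed.

Lemma overflow_leM2r z x y : (x <= y)%O -> (x * z <= y * z)%O.
Proof.
rewrite /Order.le /GRing.mul /=.
case: x y z => x [] y [] z //=.
- exact: pleM2r.
- case: (eqVneq y 0) => [-> x0|_ _]; last by case: ifP => //= _; exact: ple0.
  have -> : x = 0 by apply: ple_anti; rewrite x0 ple0.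
  by rewrite eqxx /= ple_refl.
- by move=> _; case: (eqVneq z 0) => [->|_] //=; rewrite mulr0 ple_refl.
- by move=> _; case: (x == 0); rewrite //= leUr.
- by case: (z == 0); rewrite //= ple_refl.
- by move=> xy; rewrite leU2.
Qed.

Lemma overflow_le0 x : ((0 : S) <= x)%O.
Proof. by case: x => x //; apply: ple0. Qed.

HB.instance Definition _ := InformationAlgebra_isPositive.Build S
  (@le_refl _ S) (@le_anti _ S) (@le_trans _ S)
  overflow_leD2r overflow_leM2r overflow_le0.

Lemma overflow_supremums x (l : L) :
  supremums [set x; High l] (x + High l).
Proof.
split=> [y [->|->]|y ub].
- by case: x => x //; apply: leUl.
- by case: x => x; [apply: le_refl|apply: leUr].
- have /= := ub _ (or_introl erefl); have /= := ub _ (or_intror erefl).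
  case: x y {ub} => x [] y //; rewrite /Order.le /= => ly xy.
  by rewrite leUx xy.
Qed.

End Overflow.

(* f n is the coefficient of X^n in f. *)
Record fps (R : Type) := FPS { coefs :> nat -> R }.

HB.instance Definition _ (R : Type) := gen_eqMixin (fps R).
HB.instance Definition _ (R : Type) := gen_choiceMixin (fps R).

Lemma fpsP (R : Type) (f g : fps R) : f =1 g -> f = g.
Proof. by case: f g => f [] g /funext /= ->. Qed.

Section FormalPowerSeries.
Variable R : comNzSemiRingType.
Implicit Types f g h : fps R.

Definition fps_zero : fps R := FPS (fun=> 0).
Definition fps_one : fps R := FPS (fun n => (n == 0%N)%:R).
Definition fps_add f g : fps R := FPS (fun n => f n + g n).
Definition fps_mul f g : fps R :=
  FPS (fun n => \sum_(i < n.+1) f i * g (n - i)%N).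

Lemma fps_addA : associative fps_add.
Proof. by move=> f g h; apply: fpsP => n /=; rewrite addrA. Qed.

Lemma fps_addC : commutative fps_add.
Proof. by move=> f g; apply: fpsP => n /=; rewrite addrC. Qed.

Lemma fps_add0 : left_id fps_zero fps_add.
Proof. by move=> f; apply: fpsP => n /=; rewrite add0r. Qed.

HB.instance Definition _ :=
  GRing.isNmodule.Build (fps R) fps_addA fps_addC fps_add0.

Let trunc n f : {poly R} := \poly_(i < n.+1) f i.

Let trunc_mul m n f g : (n <= m)%N ->
  fps_mul f g n = (trunc m f * trunc m g)`_n.
Proof.
move=> nm; rewrite coefM; apply: eq_bigr => i _.
rewrite !coef_poly !ltnS (leq_trans (leq_subr _ _) nm).
by rewrite (leq_trans _ nm) // -ltnS.
Qed.

Lemma fps_mulC : commutative fps_mul.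
Proof.
by move=> f g; apply: fpsP => n; rewrite !(@trunc_mul n) // mulrC.
Qed.

Lemma fps_mulA : associative fps_mul.
Proof.
move=> f g h; apply: fpsP => n.
transitivity (trunc n f * (trunc n g * trunc n h))`_n.
  rewrite coefM; apply: eq_bigr => i _.
  by rewrite coef_poly ltn_ord (@trunc_mul n) // leq_subr.
rewrite mulrA coefM; apply: eq_bigr => i _.
by rewrite coef_poly ltnS leq_subr (@trunc_mul n) // -ltnS.
Qed.

Lemma fps_mul1 : left_id fps_one fps_mul.
Proof.
move=> f; apply: fpsP => n /=; rewrite big_ord_recl /= mul1r subn0 big1 ?addr0 //.
by move=> i _; rewrite mul0r.
Qed.

Lemma fps_mul0 : left_zero fps_zero fps_mul.
Proof. by move=> f; apply: fpsP => n /=; apply: big1 => i _; rewrite mul0r. Qed.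

Lemma fps_mulDl : left_distributive fps_mul fps_add.
Proof.
move=> f g h; apply: fpsP => n /=; rewrite -big_split.
by apply: eq_bigr => i _; rewrite mulrDl.
Qed.

Lemma fps_one_neq0 : fps_one != fps_zero.
Proof.
by apply/eqP => /(congr1 (fun f : fps R => f 0%N)) /eqP; rewrite oner_eq0.
Qed.

HB.instance Definition _ := GRing.Nmodule_isComNzSemiRing.Build (fps R)
  fps_mulA fps_mulC fps_mul1 fps_mulDl fps_mul0 fps_one_neq0.

End FormalPowerSeries.

(* Main.v *)
(* Comparing coefficients of X^n for n >= 1, f^2 = f says a_n + T_n + a_n = a_n,
   where T_n is the sum of a_i a_(n-i) over 0 < i < n.  Cancellation in A forces
   a_n = 0 whenever a_n lies in A.  On the subset L u {0} addition is the binary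
   supremum, so T_n is the supremum of its terms and the equation becomes
   T_n <= a_n.  Infinitude holds because a_n <> 0 forces a_(2n) >= a_n^2 <> 0. *)
Require Import Defs.
From HB Require Import structures.
From mathcomp Require Import all_boot all_order all_algebra.
From mathcomp Require Import boolp classical_sets cardinality.

Set Implicit Arguments.
Unset Strict Implicit.
Unset Printing Implicit Defensive.

Import Order.TTheory GRing.Theory.
Local Open Scope classical_set_scope.
Local Open Scope ring_scope.

Section HighOrZero.
Variables (dL : Order.disp_t) (A : posInfoAlgType) (L : joinSemilatticeType dL).
Local Notation S := (overflow A L).
Implicit Types x y z : S.

Definition high_or_zero x : bool := if x is Low a then a == 0 else true.

(** Bridge from the boolean test to the wording of condition (1). *)
Lemma high_or_zeroP x : reflect (x <> 0 -> exists l, x = High l) (high_or_zero x).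
Proof.
case: x => [a|l] /=; last by apply: ReflectT => _; exists l.
apply: (iffP eqP) => [-> //|a_high].
by apply: contrapT => a0; case: a_high => // -[/a0].
Qed.

Lemma high_or_zeroM x y :
  high_or_zero x -> high_or_zero y -> high_or_zero (x * y).
Proof.
rewrite /GRing.mul; case: x y => [a|l] [b|m] //=.
- by move=> /eqP-> _; rewrite mul0r.
- by move=> /eqP-> _; rewrite eqxx /=.
- by move=> _ /eqP->; rewrite eqxx /=.
Qed.

Lemma high_or_zeroD x y :
  high_or_zero x -> high_or_zero y -> high_or_zero (x + y).
Proof.
rewrite /GRing.add; case: x y => [a|l] [b|m] //= /eqP-> /eqP->.
by rewrite addr0.
Qed.

Lemma overflow_leDl x y : (x <= x + y)%O.
Proof.
by have := overflow_leD2r x (overflow_le0 y); rewrite add0r addrC.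
Qed.

(** Two elements of [A] may add up to more than a common upper bound; with 0 as the only element of
    [A] allowed, the sum is a join. *)
Lemma high_or_zero_leD x y z : high_or_zero x -> high_or_zero y ->
  (x <= z)%O -> (y <= z)%O -> (x + y <= z)%O.
Proof.
rewrite /Order.le /GRing.add /=.
case: x y z => x [] y [] z //=; last by rewrite leUx => _ _ -> ->.
by move=> /eqP-> _ _; rewrite add0r.
Qed.

(** An element of [L] absorbs everything below it, whether in [A] or in [L], and only 0 lies below
    0. *)
Lemma high_or_zero_addr_eq x y : high_or_zero x -> y + x = x <-> (y <= x)%O.
Proof.
move=> x_hz; split=> [<-|yx]; first exact: overflow_leDl.
apply/le_anti; rewrite addrC overflow_leDl andbT.
case: x y x_hz yx => [x|l] [y|m] //=; rewrite /Order.le /GRing.add //=.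
- by move=> /eqP->; rewrite add0r.
- by rewrite leUx lexx.
Qed.

(** Induction on [r]: the empty sum 0 is the least element, hence the empty supremum, and each
    further term is joined on. *)
Lemma supremums_high_or_zero_sum (I : eqType) (r : seq I) (F : I -> S) :
  (forall i, i \in r -> high_or_zero (F i)) ->
  supremums [set F i | i in [set` r]] (\sum_(i <- r) F i).
Proof.
elim: r => [|j r IHr] hF.
  rewrite big_nil; split=> [y [i]|y _] //; exact: overflow_le0.
have [i ir|ubr lubr] := IHr; first by apply: hF; rewrite inE ir orbT.
rewrite big_cons; split=> [_ [i /= + <-]|y uby].
  rewrite inE => /predU1P[->|ir]; first exact: overflow_leDl.
  by rewrite addrC (le_trans _ (overflow_leDl _ _)) //; apply: ubr; exists i.
have sum_hz : high_or_zero (\sum_(i <- r) F i).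
  rewrite big_seq; apply: (big_ind (fun x => high_or_zero x)) => [|x z|i ir].
  - exact: eqxx.
  - exact: high_or_zeroD.
  - by apply: hF; rewrite inE ir orbT.
apply: high_or_zero_leD => //.
- by apply: hF; rewrite inE eqxx.
- by apply: uby; exists j; rewrite //= inE eqxx.
- apply: lubr => _ [i /= ir <-].
  by apply: uby; exists i; rewrite //= inE ir orbT.
Qed.

(** If [x] is some [a] in [A], then [y] is some [b] in [A], since otherwise the left side would lie
    in [L]. Cancelling [a] leaves [a + b = 0], and zerosumfreeness gives [a = 0]. *)
Lemma high_or_zero_addr_cancel x y : additively_cancellative A ->
  x + (x + y) = x -> high_or_zero x.
Proof.
move=> canc; rewrite /GRing.add; case: x y => [a|l] [b|m] //= [aab].
have /zerosumfree[-> _] // : a + b = 0.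
by apply: (canc _ _ a); rewrite add0r addrC.
Qed.

End HighOrZero.

(** The end terms [i = 0] and [i = n], distinct because [1 <= n], each contribute [f n]. *)
Lemma fps_sqr_coef (R : comNzSemiRingType) (f : fps R) n : f 0%N = 1 ->
  (1 <= n)%N ->
  (f ^+ 2) n = f n + (f n + \sum_(i <- index_iota 1 n) f i * f (n - i)%N).
Proof.
move=> f0; case: n => // n _; rewrite expr2.
transitivity (\sum_(0 <= i < n.+2) f i * f (n.+1 - i)%N).
  by rewrite big_mkord.
rewrite big_ltn // big_nat_recr //= subn0 subnn f0 mul1r mulr1.
by congr (_ + _); rewrite addrC.
Qed.

Theorem theorem3p12 (dL : Order.disp_t) (A : posInfoAlgType)
    (L : orderType dL) (addA_canc : additively_cancellative A)
    (f : fps (overflow A L)) (f0 : f 0%N = 1) (f_neq1 : f <> 1) :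
  f ^+ 2 = f <->
  [/\ forall n : nat, (1 <= n)%N -> f n <> 0 -> exists l : L, f n = High l,
      infinite_set [set n : nat | (1 <= n)%N /\ f n <> 0] &
      forall n : nat, (1 <= n)%N ->
        exists2 s : overflow A L,
          supremums [set f i * f (n - i)%N | i in [set i | 1 <= i <= n - 1]%N] s
          & (s <= f n)%O].
Proof.
pose T n := \sum_(i <- index_iota 1 n) f i * f (n - i)%N.
have coefE n : (1 <= n)%N -> (f ^+ 2) n = f n + (f n + T n).
  exact: fps_sqr_coef.
have sqrE n : (1 <= n)%N -> high_or_zero (f n) ->
    (f ^+ 2) n = f n <-> (T n <= f n)%O.
  move=> n1 fn; have fnn : f n + f n = f n by apply/high_or_zero_addr_eq.
  by rewrite coefE // addrA fnn addrC; apply: high_or_zero_addr_eq.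
have supT n : (forall i, (1 <= i)%N -> high_or_zero (f i)) ->
    supremums [set f i * f (n - i)%N | i in [set i | 1 <= i <= n - 1]%N] (T n).
  (* The index sets agree at [n = 0] too: [n - 1] truncates to 0 and both are empty. *)
  move=> fhz; have -> : [set i | 1 <= i <= n - 1]%N = [set` index_iota 1 n].
    apply/seteqP; split=> i /=; rewrite mem_index_iota;
      by case: n => [|n]; rewrite ?subn1 ?ltnS //; case: i.
  apply: supremums_high_or_zero_sum => i.
  rewrite mem_index_iota => /andP[i1 iltn].
  by apply: high_or_zeroM; apply: fhz => //; rewrite subn_gt0.
split=> [ff|[fhigh _ fsup]].
- have fhz n : (1 <= n)%N -> high_or_zero (f n).
    move=> n1; apply: (@high_or_zero_addr_cancel _ _ _ _ (T n)) => //.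
    by rewrite -coefE // ff.
  have Tle n : (1 <= n)%N -> (T n <= f n)%O.
    by move=> n1; apply/sqrE; rewrite ?ff //; apply: fhz.
  split=> [n n1||n n1]; first exact/high_or_zeroP/fhz.
  + have double n : (1 <= n)%N -> f n <> 0 -> f n.*2 <> 0.
      move=> n1 fn0 f2n0; have [ubT _] := supT n.*2 fhz.
      have : (f n * f n <= f n.*2)%O.
        apply: le_trans (Tle _ _); last by rewrite double_gt0.
        (* [f n * f n] is the middle term of [T n.*2]. *)
        apply: ubT; exists n => /=; last by rewrite -addnn addnK.
        by rewrite n1 -addnn -addnBA // leq_addr.
      rewrite f2n0 => le0; have := overflow_le0 (f n * f n) => ge0.
      have /overflow_entire[] // : f n * f n = 0.
      by apply/le_anti; rewrite le0 ge0.
    have [n n1 fn0] : exists2 n, (1 <= n)%N & f n <> 0.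
      apply: contrapT => noex; apply: f_neq1; apply: fpsP => -[|n] //=.
      by apply: contrapT => fn0; apply: noex; exists n.+1.
    (* Doubling an index [k > m] with [k >= 1] gives one beyond [m + 1], so the support passes every
       bound. *)
    have unbounded m : exists2 k, (m < k)%N & f k <> 0.
      elim: m => [|m [k mk fk0]]; first by exists n.
      have k0 : (0 < k)%N by apply: leq_ltn_trans mk.
      exists k.*2; last exact: double.
      by rewrite -addnn -addn1 leq_add.
    move=> /finite_seqP[s sE].
    (* A support index beyond the maximum of the finite list [s] would still have to occur in
       [s]. *)
    have [k maxk fk0] := unbounded (\max_(i <- s) i)%N.
    have ks : k \in s.
      suff : [set` s] k by [].
      by rewrite -sE; split=> //; apply: leq_ltn_trans maxk.
    by move: maxk; rewrite ltnNge leq_bigmax_seq.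
  + by exists (T n); [exact: supT|exact: Tle].
- have fhz n : (1 <= n)%N -> high_or_zero (f n).
    by move=> n1; apply/high_or_zeroP/fhigh.
  apply: fpsP => -[|n].
    by rewrite expr2 /GRing.mul /= big_ord1 f0 mul1r.
  apply/sqrE => //; first exact: fhz.
  (* [s] bounds the products from above and [T n.+1] is their least upper bound, so
     [T n.+1 <= s <= f n.+1]. *)
  have [s [ubs _]] := fsup n.+1 isT; apply: le_trans.
  by have [_] := supT n.+1 fhz; apply.
Qed.
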